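(* Let $(\beta_n)_{n\ge 1}$ and $(a_n)_{n\ge 1}$ be real sequences with $0\le \beta_n<1$ and $1<a_n\le e$ for all $n$, such that $\beta_n\to 0$ and $a_n\to e$ as $n\to\infty$. If $f\in C[0,\infty)$, then the sequence $P_n^{[\beta_n,a_n]}(f,\cdot)$ converges uniformly to $f$ on $[c,d]$, where $0\le c<d<\infty$.
   Context: $\log$ denotes the natural logarithm. For $0\le\beta<1$, $1<a\le e$, $\alpha\ge 0$ and integers $k\ge 0$, put $$\omega_{\beta,a}(k,\alpha)=\alpha(\log a)^k(\alpha+k\beta)^{k-1}\frac{a^{-(\alpha+k\beta)}}{k!},$$ where for $k=0$ the factor $\alpha\cdot\alpha^{-1}$ is read as $1$ (so $\omega_{\beta,a}(0,\alpha)=a^{-\alpha}$, also for $\alpha=0$). For $f\in C(\mathbf{R}^+)$, $\mathbf{R}^+=[0,\infty)$, $x\ge 0$ and integers $n\ge1$, define $$P_n^{[\beta,a]}(f,x)=\sum_{k=0}^\infty \omega_{\beta,a}(k,nx)\, f\!\left(\frac{k}{n}\right).$$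
   Formalization: The formal theorem additionally assumes that f has at most exponential growth, |f(x)| ≤ M e^{Ax} for x ≥ 0; for arbitrary f in C[0,∞) the claim fails, e.g. for f(x)=exp(exp x), β_n=0, a_n=e, where the series diverges. *)

(* Defs.v *)
(* Stdlib's real numbers with Coquelicot. *)
From Stdlib Require Import Reals Factorial.
From Coquelicot Require Import Coquelicot.

Open Scope R_scope.

(* The factor alpha * (alpha + k beta)^(k-1) is 1 for k = 0, including when
   alpha = 0, so that [omega beta a 0 0 = 1]; hence the case distinction. *)
Definition omega (beta a : R) (k : nat) (alpha : R) : R :=
  match k with
  | O => Rpower a (- alpha)
  | S j =>
      alpha * (ln a) ^ k * (alpha + INR k * beta) ^ j
      * Rpower a (- (alpha + INR k * beta)) / INR (fact k)
  end.

Definition P_term (beta a : R) (n : nat) (f : R -> R) (x : R) (k : nat) : R :=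
  omega beta a k (INR n * x) * f (INR k / INR n).

(* [Series] is total; this is the sum of the series only under
   [ex_series (P_term beta a n f x)]. *)
Definition P (beta a : R) (n : nat) (f : R -> R) (x : R) : R :=
  Series (P_term beta a n f x).

(* Main.v *)
Require Import Defs.
From Stdlib Require Import Reals Factorial Lra Lia.
From Coquelicot Require Import Coquelicot.

(** For [L = ln a], the weight [omega beta a k alpha] is
    [gpoisson b l k = l (l + k b)^(k-1) exp (- (l + k b)) / k!]
    with [b = L beta] and [l = L alpha]: the generalized Poisson law of Consul
    and Jain.  The operator [P] averages [f] at [k / n] against this law with
    [l = L n x], and the theorem is a law of large numbers for it.  Two facts
    about the law are needed: it has total mass 1, and its exponential moments
    at scale [1 / n] converge.

    Total mass ([is_series_gpoisson]).  Put
    [H_N mu = sum_(j <= N) (mu + j b)^j exp (- (mu + j b)) / j!].  Since the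
    Poisson weights satisfy [p_j' = p_(j-1) - p_j], the derivative of [H_N] at
    [mu] is [H_N (mu + b) - H_N mu], up to one exponentially small boundary term.
    By the mean value theorem this is [b H_N' xi] plus that small term, with [xi]
    between [mu] and [mu + b].  As [b < 1], the derivative is thus bounded by a
    contraction of itself, so it tends to 0 as [N] grows, and [H_N] is constant
    in the limit ([shifted_poisson_sum_almost_constant]).  The partial sums of
    [gpoisson b l] are [H_(N+1) l - b H_N (l + b)]; their limit therefore does
    not depend on [l], and for [l = 0] it is 1.

    Exponential moments.  Multiplying [gpoisson b l k] by [z^k] with
    [z = s exp (- b (s - 1))] gives [exp (l (s - 1))] times the weight with
    parameters [b s] and [l s] ([gpoisson_tilt]), so that the generating function
    at [z] is [exp (l (s - 1))].  Squeezing [exp (theta / n)] between two such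
    [z] encloses the mean of [exp (theta k / n)] between [exp (L theta x)] and
    [exp (L sigma x)], where [sigma] tends to [theta] ([gpoisson_exp_moment]).
    Consequently the mean of [(exp (theta k / n) - exp (theta x))^2] tends to 0,
    uniformly for [x] in a bounded interval.

    Finally, for [theta] positive and at least the growth rate of [f], these two
    properties of [f], continuity and exponential growth,
    together give
    [|f y - f x| <= eps + C (exp (theta y) - exp (theta x))^2]
    for [x] in [[0, d]] and all [y >= 0] ([exp_growth_modulus]), and averaging
    this over [y = k / n] finishes the proof as in Korovkin's theorem. *)

Open Scope R_scope.

(** * Shifted sums of Poisson weights *)

Definition poisson (j : nat) (x : R) : R := x ^ j * exp (- x) / INR (fact j).

Definition shifted_poisson_sum (b : R) (N : nat) (mu : R) : R :=
  sum_n (fun j => poisson j (mu + INR j * b)) N.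

(** The case distinction reads [l * l^(-1)] as [1] at [k = 0], also for [l = 0]. *)
Definition gpoisson (b l : R) (k : nat) : R :=
  match k with
  | O => exp (- l)
  | S j => l * (l + INR k * b) ^ j * exp (- (l + INR k * b)) / INR (fact k)
  end.

Lemma poisson_nonneg (j : nat) (x : R) : 0 <= x -> 0 <= poisson j x.
Proof.
intros Hx. unfold poisson, Rdiv.
apply Rmult_le_pos; [apply Rmult_le_pos|].
- now apply pow_le.
- left; apply exp_pos.
- left; apply Rinv_0_lt_compat, INR_fact_lt_0.
Qed.

Lemma is_derive_poisson_S (j : nat) (x : R) :
  is_derive (poisson (S j)) x (poisson j x - poisson (S j) x).
Proof.
unfold poisson. auto_derive; [easy|].
change (match j with O => 1 | S _ => INR j + 1 end) with (INR (S j)).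
change (fact j + j * fact j)%nat with (S j * fact j)%nat.
rewrite fact_simpl, mult_INR, <- tech_pow_Rmult.
field. split; [apply INR_fact_neq_0|apply not_0_INR; lia].
Qed.

Lemma exp_pow_INR (x : R) (j : nat) : exp x ^ j = exp (INR j * x).
Proof.
induction j as [|j IH].
- now rewrite Rmult_0_l, exp_0.
- rewrite <- tech_pow_Rmult, IH, S_INR, <- exp_plus. f_equal. ring.
Qed.

Lemma exp_le_exp (x y : R) : x <= y -> exp x <= exp y.
Proof.
intros [H| ->]; [left; now apply exp_increasing|apply Rle_refl].
Qed.

Lemma pow_div_fact_le_exp (j : nat) (y : R) :
  0 <= y -> y ^ j / INR (fact j) <= exp y.
Proof.
intros Hy.
apply Rle_trans with (sum_f_R0 (fun k => y ^ k / INR (fact k)) j).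
- destruct j as [|j]; [simpl; lra|].
  rewrite tech5.
  enough (0 <= sum_f_R0 (fun k => y ^ k / INR (fact k)) j) by lra.
  apply cond_pos_sum. intros k. apply Rmult_le_pos; [now apply pow_le|].
  left; apply Rinv_0_lt_compat, INR_fact_lt_0.
- apply exp_ge_taylor; lra.
Qed.

(** Exponential tilting: from [y^j / j! <= exp y] at [y = t x], a Poisson weight
    at [x] is at most [exp ((t - 1) x) / t^j].  Along [x = mu + j b] this is
    geometric in [j]. *)
Lemma poisson_tilt_bound (j : nat) (b t mu : R) :
  0 <= b -> 0 < t -> 0 <= mu ->
  poisson j (mu + INR j * b)
    <= exp ((t - 1) * mu) * (exp ((t - 1) * b) / t) ^ j.
Proof.
intros Hb Ht Hmu.
set (x := mu + INR j * b).
assert (Hx : 0 <= x).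
{ unfold x. pose proof (Rmult_le_pos _ _ (pos_INR j) Hb). lra. }
assert (H : (t * x) ^ j / INR (fact j) <= exp (t * x)).
{ apply pow_div_fact_le_exp. apply Rmult_le_pos; lra. }
assert (Htj : 0 < t ^ j) by now apply pow_lt.
replace (exp ((t - 1) * mu) * (exp ((t - 1) * b) / t) ^ j)
  with (exp (t * x) * (exp (- x) / t ^ j)).
2:{ unfold Rdiv at 2. rewrite Rpow_mult_distr, pow_inv, exp_pow_INR.
    unfold Rdiv. rewrite <- !Rmult_assoc, <- !exp_plus. f_equal. f_equal.
    unfold x. ring. }
replace (poisson j x) with ((t * x) ^ j / INR (fact j) * (exp (- x) / t ^ j)).
2:{ unfold poisson. rewrite Rpow_mult_distr. field. split; [apply INR_fact_neq_0|lra]. }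
apply Rmult_le_compat_r; [|exact H].
apply Rlt_le, Rdiv_lt_0_compat; [apply exp_pos|exact Htj].
Qed.

(** From [p_j' = p_(j-1) - p_j] the derivative is [H_(N-1) (mu + b) - H_N mu].
    Writing it with [H_N (mu + b)] isolates the last weight as an error term and
    leaves an increment of a single function. *)
Lemma is_derive_shifted_poisson_sum (b : R) (N : nat) (mu : R) :
  is_derive (shifted_poisson_sum b N) mu
    (shifted_poisson_sum b N (mu + b) - poisson N (mu + b + INR N * b)
     - shifted_poisson_sum b N mu).
Proof.
unfold shifted_poisson_sum.
induction N as [|N IH].
- apply is_derive_ext with (fun m => exp (- m)).
  { intros m. rewrite sum_O. unfold poisson. simpl. rewrite Rmult_0_l, Rplus_0_r. field. }
  rewrite !sum_O. unfold poisson. simpl. auto_derive; [easy|].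
  rewrite !Rmult_0_l, !Rplus_0_r. field.
- apply is_derive_ext with (fun m => sum_n (fun j => poisson j (m + INR j * b)) N
                                     + poisson (S N) (m + INR (S N) * b)).
  { intros m. now rewrite sum_Sn. }
  rewrite !sum_Sn. unfold plus; simpl plus.
  evar_last.
  { apply @is_derive_plus; [exact IH|].
    apply (is_derive_comp (poisson (S N)) (fun m => m + INR (S N) * b)).
    - apply is_derive_poisson_S.
    - auto_derive; [easy|reflexivity]. }
  unfold plus, scal; simpl plus; unfold mult; simpl.
  change (match N with O => 1 | S _ => INR N + 1 end) with (INR (S N)).
  rewrite S_INR.
  replace (mu + b + INR N * b) with (mu + (INR N + 1) * b) by ring.
  change mult with Rmult. ring.
Qed.

(** If a function is bounded by [b] times its own value at most [b] further to the
    right, plus an error, then weighting by [exp (kap mu)] turns this into a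
    contraction of ratio [b exp (kap b)].  Iterating removes any a priori bound
    [K], so that [K] leaves no trace in the conclusion. *)
Lemma iterate_weighted_bound (Q : R -> R) (b kap E K : R) :
  0 <= b -> 0 <= kap -> b * exp (kap * b) < 1 ->
  (forall mu, 0 <= mu -> Rabs (Q mu) <= K * exp (kap * mu)) ->
  (forall mu, 0 <= mu -> exists xi, mu <= xi <= mu + b /\
     Rabs (Q mu) <= b * Rabs (Q xi) + E * exp (kap * mu)) ->
  forall mu, 0 <= mu ->
    Rabs (Q mu) <= E / (1 - b * exp (kap * b)) * exp (kap * mu).
Proof.
intros Hb Hk Hrho HK Hrec.
set (rho := b * exp (kap * b)) in *.
assert (Hrho0 : 0 <= rho).
{ apply Rmult_le_pos; [exact Hb|left; apply exp_pos]. }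
assert (HK0 : 0 <= K).
{ specialize (HK 0 (Rle_refl 0)). rewrite Rmult_0_r, exp_0 in HK.
  pose proof (Rabs_pos (Q 0)). lra. }
assert (Hiter : forall (m : nat) mu, 0 <= mu ->
  Rabs (Q mu) <= (rho ^ m * (K - E / (1 - rho)) + E / (1 - rho)) * exp (kap * mu)).
{ induction m as [|m IH]; intros mu Hmu.
  - simpl. rewrite Rmult_1_l. replace (K - _ + _) with K by ring. now apply HK.
  - destruct (Hrec mu Hmu) as (xi & Hxi & HQ).
    specialize (IH xi ltac:(lra)).
    set (B := rho ^ m * (K - E / (1 - rho)) + E / (1 - rho)) in *.
    assert (HB : 0 <= B).
    { destruct (Rle_or_lt 0 B) as [H|H]; [exact H|exfalso].
      pose proof (Rabs_pos (Q xi)). pose proof (exp_pos (kap * xi)). nra. }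
    assert (He : exp (kap * xi) <= exp (kap * b) * exp (kap * mu)).
    { rewrite <- exp_plus. apply exp_le_exp. nra. }
    apply (Rle_trans _ _ _ HQ).
    apply Rle_trans with (b * (B * (exp (kap * b) * exp (kap * mu))) + E * exp (kap * mu)).
    + apply Rplus_le_compat_r, Rmult_le_compat_l; [exact Hb|].
      apply (Rle_trans _ _ _ IH). now apply Rmult_le_compat_l.
    + right. unfold B, rho. simpl. field. fold rho. lra. }
intros mu Hmu.
apply (is_lim_seq_le (fun _ => Rabs (Q mu))
  (fun m => (rho ^ m * (K - E / (1 - rho)) + E / (1 - rho)) * exp (kap * mu))
  (Rabs (Q mu)) (E / (1 - rho) * exp (kap * mu))).
- intros m. now apply Hiter.
- apply is_lim_seq_const.
- replace (E / (1 - rho) * exp (kap * mu)) with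
    ((0 * (K - E / (1 - rho)) + E / (1 - rho)) * exp (kap * mu)) by ring.
  apply (is_lim_seq_scal_r _ (exp (kap * mu)) (Finite _)).
  apply is_lim_seq_plus'; [|apply is_lim_seq_const].
  apply (is_lim_seq_scal_r _ _ (Finite 0)).
  apply is_lim_seq_geom. rewrite Rabs_pos_eq; lra.
Qed.

Lemma shifted_poisson_sum_nonneg (b : R) (N : nat) (mu : R) :
  0 <= b -> 0 <= mu -> 0 <= shifted_poisson_sum b N mu.
Proof.
intros Hb Hmu. unfold shifted_poisson_sum. rewrite sum_n_Reals.
apply cond_pos_sum. intros j. apply poisson_nonneg.
pose proof (Rmult_le_pos _ _ (pos_INR j) Hb). lra.
Qed.

(** This is the bound [exp y <= 1 / (1 - y)] at [y = (t - 1) b]: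
    [t (1 - y) - 1 = (t - 1) (1 - t b)] is positive.  It leaves room for a tilt
    [t] strictly above [1] exactly when [b < 1]. *)
Lemma exp_tilt_lt (b t : R) :
  0 <= b -> 1 < t -> b * t < 1 -> exp ((t - 1) * b) < t.
Proof.
intros Hb Ht Hbt.
pose proof (exp_ineq1_le (- ((t - 1) * b))) as H.
rewrite exp_Ropp in H. pose proof (exp_pos ((t - 1) * b)) as Hp.
assert (H2 : exp ((t - 1) * b) * (1 + - ((t - 1) * b)) <= 1).
{ apply (Rmult_le_compat_l (exp ((t - 1) * b))) in H; [|lra].
  rewrite Rinv_r in H by lra. exact H. }
assert (H3 : 1 < t * (1 + - ((t - 1) * b))) by nra.
assert (0 < 1 + - ((t - 1) * b)) by nra. nra.
Qed.

Lemma shifted_poisson_sum_le (b kap r : R) (N : nat) (mu : R) :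
  r <= 1 -> 0 <= r ->
  (forall j, poisson j (mu + INR j * b) <= exp (kap * mu) * r ^ j) ->
  shifted_poisson_sum b N mu <= INR (S N) * exp (kap * mu).
Proof.
intros Hr1 Hr0 Hp. unfold shifted_poisson_sum.
rewrite <- sum_n_const, !sum_n_Reals. apply sum_Rle. intros j _.
apply (Rle_trans _ _ _ (Hp j)).
rewrite <- (Rmult_1_r (exp (kap * mu))) at 2.
apply Rmult_le_compat_l; [left; apply exp_pos|].
rewrite <- (pow1 j). now apply pow_incr.
Qed.

(** For [N] to infinity this says that [sum_j (mu + j b)^j exp (- (mu + j b)) / j!]
    does not depend on [mu] (it is [1 / (1 - b)]).  Working with partial sums
    avoids differentiating the series term by term. *)
Lemma shifted_poisson_sum_almost_constant (b : R) :
  0 <= b < 1 ->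
  exists kap C r, 0 <= r < 1 /\ forall (N : nat) (nu : R), 0 <= nu ->
    Rabs (shifted_poisson_sum b N nu - shifted_poisson_sum b N 0)
      <= nu * (C * exp (kap * nu)) * r ^ N.
Proof.
intros Hb.
(* any tilt in the interval from 1 to 1 / b would do *)
set (t := 2 / (1 + b)).
assert (Ht : 1 < t).
{ unfold t. apply (Rmult_lt_reg_r (1 + b)); [lra|]. field_simplify; lra. }
assert (Hbt : b * t < 1).
{ unfold t. apply (Rmult_lt_reg_r (1 + b)); [lra|]. field_simplify; lra. }
pose proof (exp_tilt_lt b t (proj1 Hb) Ht Hbt) as He.
set (kap := t - 1) in *.
set (r := exp (kap * b) / t). set (rho := b * exp (kap * b)).
assert (Hr : r < 1).
{ unfold r. apply (Rmult_lt_reg_r t); [lra|]. field_simplify; lra. }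
assert (Hrho : rho < 1).
{ apply Rle_lt_trans with (b * t); [|exact Hbt].
  apply Rmult_le_compat_l; lra. }
assert (Hr0 : 0 <= r).
{ apply Rlt_le, Rdiv_lt_0_compat; [apply exp_pos|lra]. }
assert (Hkap : 0 < kap) by (unfold kap; lra).
assert (Hbound : forall mu j, 0 <= mu ->
  poisson j (mu + INR j * b) <= exp (kap * mu) * r ^ j).
{ intros mu j Hmu. apply poisson_tilt_bound; lra. }
exists kap, (exp (kap * b) / (1 - rho)), r. split; [lra|].
intros N nu Hnu.
set (H := shifted_poisson_sum b N).
set (Q := fun mu => H (mu + b) - poisson N (mu + b + INR N * b) - H mu).
assert (HQ : forall mu, is_derive H mu (Q mu)).
{ intros mu. apply is_derive_shifted_poisson_sum. }
assert (Hmvt : forall x y, 0 <= x <= y ->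
  exists xi, x <= xi <= y /\ H y - H x = Q xi * (y - x)).
{ intros x y Hxy.
  destruct (MVT_gen H x y Q) as (xi & Hxi & E).
  - intros z _. apply HQ.
  - intros z _. apply continuity_pt_filterlim.
    apply @ex_derive_continuous with (K := R_AbsRing) (V := R_NormedModule).
    exists (Q z). apply HQ.
  - rewrite Rmin_left, Rmax_right in Hxi by lra. now exists xi. }
assert (Hexp : forall mu, exp (kap * (mu + b)) = exp (kap * b) * exp (kap * mu)).
{ intros mu. rewrite <- exp_plus. f_equal. ring. }
assert (Hlast : forall mu, 0 <= mu ->
  0 <= poisson N (mu + b + INR N * b) <= exp (kap * b) * r ^ N * exp (kap * mu)).
{ intros mu Hmu. split.
  - apply poisson_nonneg. pose proof (Rmult_le_pos _ b (pos_INR N)). lra.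
  - eapply Rle_trans; [apply Hbound; lra|]. rewrite Hexp. right; ring. }
assert (Hder : forall mu, 0 <= mu ->
  Rabs (Q mu) <= exp (kap * b) * r ^ N / (1 - rho) * exp (kap * mu)).
{ apply iterate_weighted_bound with
    (K := INR (S N) * exp (kap * b) + exp (kap * b) * r ^ N + INR (S N));
    fold rho; try lra.
  - intros mu Hmu.
    assert (H1 : 0 <= H mu <= INR (S N) * exp (kap * mu)).
    { split; [apply shifted_poisson_sum_nonneg; lra|].
      apply shifted_poisson_sum_le with r; try lra. intros j; now apply Hbound. }
    assert (H2 : 0 <= H (mu + b) <= INR (S N) * exp (kap * (mu + b))).
    { split; [apply shifted_poisson_sum_nonneg; lra|].
      apply shifted_poisson_sum_le with r; try lra. intros j; apply Hbound; lra. }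
    rewrite Hexp in H2. specialize (Hlast mu Hmu).
    apply Rabs_le. unfold Q. lra.
  - intros mu Hmu.
    destruct (Hmvt mu (mu + b)) as (xi & Hxi & E); [lra|].
    exists xi. split; [exact Hxi|].
    replace (Q mu) with (b * Q xi + - poisson N (mu + b + INR N * b)).
    2:{ unfold Q at 2. replace (mu + b - mu) with b in E by ring. lra. }
    eapply Rle_trans; [apply Rabs_triang|].
    rewrite Rabs_mult, (Rabs_pos_eq b), Rabs_Ropp,
      (Rabs_pos_eq (poisson _ _)); [|now apply Hlast|lra].
    apply Rplus_le_compat_l. now apply Hlast. }
destruct (Hmvt 0 nu) as (xi & Hxi & E); [lra|].
rewrite E, Rabs_mult, Rminus_0_r, (Rabs_pos_eq nu Hnu), Rmult_comm, Rmult_assoc.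
apply Rmult_le_compat_l; [exact Hnu|].
eapply Rle_trans; [apply Hder; lra|].
replace (exp (kap * b) / (1 - rho) * exp (kap * nu) * r ^ N)
  with (exp (kap * b) * r ^ N / (1 - rho) * exp (kap * nu)) by (field; lra).
apply Rmult_le_compat_l.
- apply Rmult_le_pos; [|left; apply Rinv_0_lt_compat; lra].
  apply Rmult_le_pos; [left; apply exp_pos|now apply pow_le].
- apply exp_le_exp, Rmult_le_compat_l; unfold kap; lra.
Qed.

(** * The generalized Poisson law *)

Lemma gpoisson_nonneg (b l : R) (k : nat) :
  0 <= b -> 0 <= l -> 0 <= gpoisson b l k.
Proof.
intros Hb Hl. destruct k as [|j]; [left; apply exp_pos|].
unfold gpoisson, Rdiv.
apply Rmult_le_pos; [|left; apply Rinv_0_lt_compat, INR_fact_lt_0].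
apply Rmult_le_pos; [|left; apply exp_pos].
apply Rmult_le_pos; [exact Hl|]. apply pow_le.
pose proof (Rmult_le_pos _ _ (pos_INR (S j)) Hb). lra.
Qed.

(** [l (l + k b)^(k-1) = (l + k b)^k - k b (l + k b)^(k-1)]. *)
Lemma gpoisson_S_poisson (b l : R) (j : nat) :
  gpoisson b l (S j)
  = poisson (S j) (l + INR (S j) * b) - b * poisson j (l + b + INR j * b).
Proof.
unfold gpoisson, poisson.
replace (l + b + INR j * b) with (l + INR (S j) * b) by (rewrite S_INR; ring).
rewrite fact_simpl, mult_INR, <- tech_pow_Rmult.
field. split; [apply INR_fact_neq_0|apply not_0_INR; lia].
Qed.

Lemma sum_gpoisson (b l : R) (N : nat) :
  sum_n (gpoisson b l) (S N)
  = shifted_poisson_sum b (S N) l - b * shifted_poisson_sum b N (l + b).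
Proof.
unfold shifted_poisson_sum.
induction N as [|N IH].
- rewrite !sum_Sn, !sum_O, gpoisson_S_poisson. change plus with Rplus.
  replace (gpoisson b l 0) with (poisson 0 (l + INR 0 * b)).
  { match goal with |- ?x = ?y => change (@eq R x y) end. ring. }
  unfold poisson, gpoisson. simpl. rewrite Rmult_0_l, Rplus_0_r. field.
- rewrite sum_Sn, IH, gpoisson_S_poisson, !sum_Sn. change plus with Rplus.
  match goal with |- ?x = ?y => change (@eq R x y) end. ring.
Qed.

(** The partial sums at [l] and at [0] are the same combination of almost constant
    functions, and at [l = 0] all the mass sits at [k = 0]. *)
Lemma is_series_gpoisson (b l : R) :
  0 <= b < 1 -> 0 <= l -> is_series (gpoisson b l) 1.
Proof.
intros Hb Hl.
destruct (shifted_poisson_sum_almost_constant b Hb) as (kap & C & r & Hr & HH).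
change (is_lim_seq (sum_n (gpoisson b l)) 1).
apply is_lim_seq_incr_1.
set (D := fun N nu => shifted_poisson_sum b N nu - shifted_poisson_sum b N 0).
assert (HD : forall nu, 0 <= nu -> is_lim_seq (fun N => D N nu) 0).
{ intros nu Hnu. apply is_lim_seq_abs_0.
  apply (is_lim_seq_le_le (fun _ => 0) _
           (fun N => nu * (C * exp (kap * nu)) * r ^ N)).
  - intros N. split; [apply Rabs_pos|now apply HH].
  - apply is_lim_seq_const.
  - replace (Finite 0) with (Rbar_mult (nu * (C * exp (kap * nu))) 0)
      by (simpl; f_equal; ring).
    apply is_lim_seq_scal_l, is_lim_seq_geom. rewrite Rabs_pos_eq; lra. }
assert (H0 : forall N, sum_n (gpoisson b 0) N = 1).
{ induction N as [|N IH].
  - rewrite sum_O. simpl. now rewrite Ropp_0, exp_0.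
  - rewrite sum_Sn, IH. unfold plus; simpl. unfold Rdiv. ring. }
apply is_lim_seq_ext with
  (fun N => 1 + D (S N) l - b * (D N (l + b) - D N b)).
{ intros N. rewrite <- (H0 (S N)), !sum_gpoisson. unfold D.
  rewrite Rplus_0_l. ring. }
replace (Finite 1) with (Finite (1 + 0 - b * (0 - 0))) by (f_equal; ring).
apply is_lim_seq_minus'.
- apply is_lim_seq_plus'; [apply is_lim_seq_const|].
  apply (is_lim_seq_incr_1 (fun N => D N l)). now apply HD.
- apply (is_lim_seq_scal_l _ b (Finite _)).
  apply is_lim_seq_minus'; apply HD; lra.
Qed.

(** The family is closed under exponential tilting, which makes its generating
    function computable from the total mass alone. *)
Lemma gpoisson_tilt (b l s : R) (k : nat) :
  gpoisson b l k * (s * exp (- (b * (s - 1)))) ^ k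
  = exp (l * (s - 1)) * gpoisson (b * s) (l * s) k.
Proof.
destruct k as [|j].
- simpl. rewrite Rmult_1_r, <- exp_plus. f_equal. ring.
- unfold gpoisson. rewrite Rpow_mult_distr, exp_pow_INR.
  set (k := INR (S j)).
  replace (l * s + k * (b * s)) with (s * (l + k * b)) by ring.
  replace (exp (- (s * (l + k * b)))) with
    (exp (- (l + k * b)) * exp (k * - (b * (s - 1))) * exp (- (l * (s - 1)))).
  2:{ rewrite <- !exp_plus. f_equal. ring. }
  rewrite Rpow_mult_distr, <- tech_pow_Rmult, (exp_Ropp (l * (s - 1))).
  field. split; [|apply INR_fact_neq_0].
  apply Rgt_not_eq, exp_pos.
Qed.

Lemma is_series_gpoisson_pow (b l s : R) :
  0 <= b -> 0 <= l -> 0 <= s -> b * s < 1 ->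
  is_series (fun k => gpoisson b l k * (s * exp (- (b * (s - 1)))) ^ k)
    (exp (l * (s - 1))).
Proof.
intros Hb Hl Hs Hbs.
apply is_series_ext with
  (fun k => scal (exp (l * (s - 1))) (gpoisson (b * s) (l * s) k)).
{ intros k. symmetry. apply gpoisson_tilt. }
evar_last; [|apply Rmult_1_r].
apply (is_series_scal_l (exp (l * (s - 1))) _ 1).
apply is_series_gpoisson; [split; [now apply Rmult_le_pos|exact Hbs]|].
now apply Rmult_le_pos.
Qed.

Lemma omega_gpoisson (beta a alpha : R) (k : nat) :
  omega beta a k alpha = gpoisson (ln a * beta) (ln a * alpha) k.
Proof.
destruct k as [|j]; unfold omega, gpoisson, Rpower.
- f_equal. ring.
- set (k := INR (S j)).
  replace (ln a * alpha + k * (ln a * beta)) with (ln a * (alpha + k * beta)) by ring.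
  rewrite Rpow_mult_distr, <- (tech_pow_Rmult (ln a)).
  replace (- (alpha + k * beta) * ln a) with (- (ln a * (alpha + k * beta))) by ring.
  field. apply INR_fact_neq_0.
Qed.

(** The equation [exp h = s exp (- b (s - 1))] has no closed solution [s]; the
    values [s = 1 + h] and [s = 1 + h / (1 - b - 2 h)] lie below and above it, and
    agree to first order as [b] and [h] tend to 0. *)
Lemma gpoisson_exp_moment (b l h : R) :
  0 <= b -> 0 <= l -> 0 < h -> b + 2 * h <= 1 / 2 ->
  exists S, is_series (fun k => gpoisson b l k * exp h ^ k) S /\
    exp (l * h) <= S <= exp (l * (h / (1 - b - 2 * h))).
Proof.
intros Hb Hl Hh Hbh.
set (v := h / (1 - b - 2 * h)).
assert (Hv : v * (1 - b - 2 * h) = h) by (unfold v; field; lra).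
assert (Hv1 : 0 < v <= 2 * h) by nra.
assert (Hlow : is_series (fun k => gpoisson b l k * ((1 + h) * exp (- (b * h))) ^ k)
                 (exp (l * h))).
{ pose proof (is_series_gpoisson_pow b l (1 + h)) as H.
  replace (1 + h - 1) with h in H by ring. apply H; nra. }
assert (Hupp : is_series (fun k => gpoisson b l k * ((1 + v) * exp (- (b * v))) ^ k)
                 (exp (l * v))).
{ pose proof (is_series_gpoisson_pow b l (1 + v)) as H.
  replace (1 + v - 1) with v in H by ring. apply H; nra. }
(* [1 + h <= exp h] *)
assert (Hzlow : 0 <= (1 + h) * exp (- (b * h)) <= exp h).
{ pose proof (exp_pos (- (b * h))). pose proof (exp_ineq1_le h).
  assert (exp (- (b * h)) <= 1) by (rewrite <- exp_0; apply exp_le_exp; nra).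
  split; [nra|]. rewrite <- (Rmult_1_r (exp h)).
  apply Rmult_le_compat; lra. }
(* [exp (v / (1 + v)) <= 1 + v] and [h = v (1 - b - 2 h) <= v / (1 + v) - b v] *)
assert (Hzupp : exp h <= (1 + v) * exp (- (b * v))).
{ assert (Hw : exp (v / (1 + v)) <= 1 + v).
  { pose proof (exp_ineq1_le (- (v / (1 + v)))) as H.
    rewrite exp_Ropp in H. pose proof (exp_pos (v / (1 + v))) as Hp.
    replace (1 + - (v / (1 + v))) with (/ (1 + v)) in H by (field; lra).
    apply Rinv_le_contravar in H; [|apply Rinv_0_lt_compat; lra].
    now rewrite !Rinv_inv in H. }
  apply Rle_trans with (exp (v / (1 + v)) * exp (- (b * v))).
  - rewrite <- exp_plus. apply exp_le_exp.
    assert (v * (1 - v) <= v / (1 + v)).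
    { apply (Rmult_le_reg_r (1 + v)); [lra|]. field_simplify; nra. }
    nra.
  - apply Rmult_le_compat_r; [left; apply exp_pos|exact Hw]. }
assert (Hw := gpoisson_nonneg b l).
assert (Hle1 : forall k, 0 <= gpoisson b l k * ((1 + h) * exp (- (b * h))) ^ k
                         <= gpoisson b l k * exp h ^ k).
{ intros k. split.
  - apply Rmult_le_pos; [now apply Hw|now apply pow_le].
  - apply Rmult_le_compat_l; [now apply Hw|now apply pow_incr]. }
assert (Hle2 : forall k, 0 <= gpoisson b l k * exp h ^ k
                    <= gpoisson b l k * ((1 + v) * exp (- (b * v))) ^ k).
{ intros k. pose proof (exp_pos h). split.
  - apply Rmult_le_pos; [now apply Hw|apply pow_le; lra].
  - apply Rmult_le_compat_l; [now apply Hw|apply pow_incr; lra]. }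
assert (Hex : ex_series (fun k => gpoisson b l k * exp h ^ k)).
{ apply (@ex_series_le R_AbsRing R_CompleteNormedModule) with (2 := ex_intro _ _ Hupp).
  intros k. unfold norm; simpl. unfold abs; simpl.
  rewrite Rabs_pos_eq; apply Hle2. }
exists (Series (fun k => gpoisson b l k * exp h ^ k)). split.
- now apply Series_correct.
- rewrite <- (is_series_unique _ _ Hlow), <- (is_series_unique _ _ Hupp). split.
  + now apply Series_le.
  + apply Series_le; [exact Hle2|now eexists; exact Hupp].
Qed.

Lemma gpoisson_exp_variance (b l h E : R) :
  0 <= b -> 0 <= l -> 0 < h -> b + 4 * h <= 1 / 2 -> 0 <= E ->
  exists V, is_series (fun k => gpoisson b l k * (exp h ^ k - E) ^ 2) V /\
    V <= exp (l * (2 * h / (1 - b - 4 * h))) - 2 * E * exp (l * h) + E ^ 2.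
Proof.
intros Hb Hl Hh Hbh HE.
destruct (gpoisson_exp_moment b l h) as (S1 & HS1 & HB1); try lra.
destruct (gpoisson_exp_moment b l (2 * h)) as (S2 & HS2 & HB2); try lra.
assert (HS0 : is_series (gpoisson b l) 1) by (apply is_series_gpoisson; lra).
exists (S2 + (-2 * E) * S1 + E ^ 2 * 1). split.
- apply is_series_ext with (fun k =>
    plus (plus (gpoisson b l k * exp (2 * h) ^ k)
               (scal (-2 * E) (gpoisson b l k * exp h ^ k)))
         (scal (E ^ 2) (gpoisson b l k))).
  { intros k. unfold plus, scal; simpl; unfold mult; simpl.
    replace (2 * h) with (h + h) by ring. rewrite exp_plus, Rpow_mult_distr. ring. }
  apply (is_series_plus _ _ (S2 + (-2 * E) * S1) (E ^ 2 * 1)).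
  + apply (is_series_plus _ _ S2 ((-2 * E) * S1)); [exact HS2|].
    now apply (is_series_scal_l (-2 * E) _ S1).
  + now apply (is_series_scal_l (E ^ 2) _ 1).
- replace (2 * (2 * h)) with (4 * h) in HB2 by ring.
  assert (2 * E * exp (l * h) <= 2 * E * S1) by (apply Rmult_le_compat_l; lra).
  lra.
Qed.

(** At [L = 1] and [sigma = 2 theta] the left side is 0.  The right side measures
    the deviation from these values, without [x]. *)
Lemma exp_variance_bound_uniform (L theta sigma x d : R) :
  0 <= L <= 1 -> 0 <= theta -> 2 * theta <= sigma -> 0 <= x <= d ->
  exp (L * x * sigma) - 2 * exp (theta * x) * exp (L * x * theta)
    + exp (theta * x) ^ 2
  <= exp (2 * theta * d)
     * (exp (d * (sigma - 2 * theta)) - 1 + 2 * ((1 - L) * theta * d)).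
Proof.
intros HL Hth Hsig Hx.
set (e := exp (2 * theta * x)).
assert (He : 0 < e <= exp (2 * theta * d)).
{ split; [apply exp_pos|]. apply exp_le_exp, Rmult_le_compat_l; lra. }
assert (H1 : exp (L * x * sigma) <= e * exp (d * (sigma - 2 * theta))).
{ unfold e. rewrite <- exp_plus. apply exp_le_exp.
  apply Rle_trans with (1 * x * sigma).
  - apply Rmult_le_compat_r; [lra|]. apply Rmult_le_compat_r; lra.
  - assert (x * (sigma - 2 * theta) <= d * (sigma - 2 * theta))
      by (apply Rmult_le_compat_r; lra).
    lra. }
assert (H2 : e * (1 - (1 - L) * theta * d) <= exp (theta * x) * exp (L * x * theta)).
{ rewrite <- exp_plus.
  replace (theta * x + L * x * theta) with (2 * theta * x + - ((1 - L) * theta * x))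
    by ring.
  rewrite exp_plus. fold e. apply Rmult_le_compat_l; [lra|].
  apply Rle_trans with (1 + - ((1 - L) * theta * x)); [|apply exp_ineq1_le].
  assert ((1 - L) * theta * x <= (1 - L) * theta * d).
  { apply Rmult_le_compat_l; [apply Rmult_le_pos|]; lra. }
  lra. }
assert (H3 : exp (theta * x) ^ 2 = e).
{ unfold e. rewrite exp_pow_INR. f_equal. simpl. ring. }
apply Rle_trans with
  (e * (exp (d * (sigma - 2 * theta)) - 1 + 2 * ((1 - L) * theta * d))).
- rewrite H3. lra.
- apply Rmult_le_compat_r; [|lra].
  assert (exp 0 <= exp (d * (sigma - 2 * theta)))
    by (apply exp_le_exp, Rmult_le_pos; lra).
  rewrite exp_0 in H.
  assert (0 <= (1 - L) * theta * d).
  { apply Rmult_le_pos; [apply Rmult_le_pos|]; lra. }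
  lra.
Qed.

(** * Approximation by averages *)

(** The averaging step of Korovkin's method, where [q] plays the role of the
    squared distance from the point at which [phi] has the value [c].  The
    domination by [q] also yields summability of the possibly unbounded [phi]. *)
Lemma weighted_series_approx (w q phi : nat -> R) (V c eps C : R) :
  (forall k, 0 <= w k) -> is_series w 1 -> is_series (fun k => w k * q k) V ->
  (forall k, Rabs (phi k - c) <= eps + C * q k) ->
  ex_series (fun k => w k * phi k) /\
  Rabs (Series (fun k => w k * phi k) - c) <= eps + C * V.
Proof.
intros Hw Hw1 HV Hphi.
assert (Hmaj : is_series (fun k => w k * (eps + C * q k)) (eps * 1 + C * V)).
{ apply is_series_ext with (fun k => plus (scal eps (w k)) (scal C (w k * q k))).
  { intros k. unfold plus, scal; simpl; unfold mult; simpl. ring. }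
  apply (is_series_plus _ _ (eps * 1) (C * V)).
  - now apply (is_series_scal_l eps _ 1).
  - now apply (is_series_scal_l C _ V). }
assert (Hle : forall k, 0 <= Rabs (w k * (phi k - c)) <= w k * (eps + C * q k)).
{ intros k. split; [apply Rabs_pos|].
  rewrite Rabs_mult, (Rabs_pos_eq _ (Hw k)). now apply Rmult_le_compat_l. }
assert (Habs : ex_series (fun k => Rabs (w k * (phi k - c)))).
{ apply (@ex_series_le R_AbsRing R_CompleteNormedModule) with (2 := ex_intro _ _ Hmaj).
  intros k. unfold norm; simpl. unfold abs; simpl. rewrite Rabs_Rabsolu. apply Hle. }
assert (Hphi' : is_series (fun k => w k * phi k)
                  (Series (fun k => w k * (phi k - c)) + c * 1)).
{ apply is_series_ext with (fun k => plus (w k * (phi k - c)) (scal c (w k))).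
  { intros k. unfold plus, scal; simpl; unfold mult; simpl. ring. }
  apply (is_series_plus _ _ (Series _) (c * 1)).
  - apply Series_correct, ex_series_Rabs, Habs.
  - now apply (is_series_scal_l c _ 1). }
split; [eexists; exact Hphi'|].
rewrite (is_series_unique _ _ Hphi').
replace (Series _ + c * 1 - c) with (Series (fun k => w k * (phi k - c))) by ring.
apply (Rle_trans _ _ _ (Series_Rabs _ Habs)).
replace (eps + C * V) with (eps * 1 + C * V) by ring.
rewrite <- (is_series_unique _ _ Hmaj).
apply Series_le; [exact Hle|eexists; exact Hmaj].
Qed.

Lemma exp_separates (theta u v : R) :
  1 <= theta -> 0 <= u -> 0 <= v ->
  Rabs (u - v) <= Rabs (exp (theta * u) - exp (theta * v)).
Proof.
intros Hth.
assert (H : forall u v, 0 <= u <= v -> v - u <= exp (theta * v) - exp (theta * u)).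
{ clear u v. intros u v Huv.
  replace (theta * v) with (theta * u + theta * (v - u)) by ring. rewrite exp_plus.
  assert (H1 : 1 <= exp (theta * u)).
  { rewrite <- exp_0 at 1. apply exp_le_exp, Rmult_le_pos; lra. }
  assert (H2 := exp_ineq1_le (theta * (v - u))).
  assert (1 * (v - u) <= theta * (v - u)) by (apply Rmult_le_compat_r; lra).
  nra. }
intros Hu Hv. destruct (Rle_or_lt u v) as [Huv|Huv].
- rewrite Rabs_minus_sym, (Rabs_minus_sym (exp _)).
  specialize (H u v ltac:(lra)). rewrite !Rabs_pos_eq; lra.
- specialize (H v u ltac:(lra)). rewrite !Rabs_pos_eq; lra.
Qed.

(** Continuity relative to the half-line becomes continuity on the whole line for
    [x |-> f (Rmax 0 x)], to which compactness of [[0, T]] applies. *)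
Lemma uniformly_continuous_nonneg (f : R -> R) (T : R) :
  continuous_on (fun x : R => 0 <= x) f ->
  forall eps, 0 < eps -> exists delta, 0 < delta /\
    forall x y, 0 <= x <= T -> 0 <= y <= T -> Rabs (y - x) < delta ->
      Rabs (f y - f x) < eps.
Proof.
intros hf eps Heps.
set (g := fun x => f (Rmax 0 x)).
assert (Hg : forall x, continuous g x).
{ intros x. unfold g.
  apply filterlim_comp with (within (fun y => 0 <= y) (locally (Rmax 0 x))).
  - intros P HP. unfold filtermap. unfold within in HP.
    assert (Hmax : continuous (fun y => Rmax 0 y) x).
    { apply (continuous_ext (fun y => (0 + y + Rabs (0 - y)) / 2)).
      - intros y. unfold Rmax. destruct (Rle_dec 0 y).
        + rewrite Rabs_left1; lra.
        + rewrite Rabs_pos_eq; lra.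
      - apply continuity_pt_filterlim. reg. }
    specialize (Hmax _ HP). unfold filtermap in Hmax.
    revert Hmax. apply filter_imp. intros y Hy. apply Hy, Rmax_l.
  - apply hf, Rmax_l. }
destruct (unifcont_normed_1d g 0 T (fun x _ => Hg x) (mkposreal eps Heps)) as [delta Hd].
exists delta. split; [apply cond_pos|].
intros x y Hx Hy Hxy. specialize (Hd x y Hx Hy Hxy).
unfold g in Hd. rewrite !Rmax_right in Hd by lra. exact Hd.
Qed.

(** Near [x] uniform continuity suffices.  At distance at least [delta] from [x], the
    difference [r = |exp (theta y) - exp (theta x)|] is at least [delta], so the
    growth bound, which is affine in [r], is dominated by a multiple of [r^2]. *)
Lemma exp_growth_modulus (f : R -> R) (d eps : R) :
  continuous_on (fun x : R => 0 <= x) f ->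
  (exists M A : R, forall x : R, 0 <= x -> Rabs (f x) <= M * exp (A * x)) ->
  0 < eps ->
  exists theta C, 0 < theta /\ 0 <= C /\
    forall x y, 0 <= x <= d -> 0 <= y ->
      Rabs (f y - f x) <= eps + C * (exp (theta * y) - exp (theta * x)) ^ 2.
Proof.
intros hf (M & A & Hgr) Heps.
assert (HM : 0 <= M).
{ specialize (Hgr 0 (Rle_refl 0)). rewrite Rmult_0_r, exp_0 in Hgr.
  pose proof (Rabs_pos (f 0)). lra. }
set (theta := Rmax 1 A).
assert (Hth : 1 <= theta) by apply Rmax_l.
assert (Hgr' : forall x, 0 <= x -> Rabs (f x) <= M * exp (theta * x)).
{ intros x Hx. apply (Rle_trans _ _ _ (Hgr x Hx)).
  apply Rmult_le_compat_l; [exact HM|].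
  apply exp_le_exp, Rmult_le_compat_r; [exact Hx|apply Rmax_r]. }
destruct (uniformly_continuous_nonneg f (d + 1) hf eps Heps) as (d0 & Hd0 & Huc).
set (delta := Rmin d0 1).
assert (Hdelta : 0 < delta) by (apply Rmin_pos; lra).
assert (Hdd0 : delta <= d0) by apply Rmin_l.
assert (Hd1 : delta <= 1) by apply Rmin_r.
set (W := exp (theta * d)).
assert (HW : 0 < W) by apply exp_pos.
exists theta, (M / delta + 2 * M * W / delta ^ 2).
assert (HC1 : 0 <= M / delta).
{ apply Rmult_le_pos; [exact HM|left; now apply Rinv_0_lt_compat]. }
assert (HC2 : 0 <= 2 * M * W / delta ^ 2).
{ apply Rmult_le_pos; [|left; apply Rinv_0_lt_compat; now apply pow_lt].
  apply Rmult_le_pos; lra. }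
split; [lra|]. split; [lra|].
intros x y Hx Hy.
set (u := exp (theta * y)). set (v := exp (theta * x)).
pose proof (pow2_ge_0 (u - v)) as Hsq.
destruct (Rlt_or_le (Rabs (y - x)) delta) as [Hn|Hf].
- assert (Hyx := Rabs_def2 _ _ Hn).
  specialize (Huc x y ltac:(lra) ltac:(lra) ltac:(lra)).
  pose proof (Rmult_le_pos _ _ (Rplus_le_le_0_compat _ _ HC1 HC2) Hsq). lra.
- assert (Hsep : delta <= Rabs (u - v)).
  { apply (Rle_trans _ _ _ Hf). apply exp_separates; lra. }
  rewrite <- (pow2_abs (u - v)) in *. set (r := Rabs (u - v)) in *.
  assert (Hv : v <= W) by (apply exp_le_exp, Rmult_le_compat_l; lra).
  assert (Hu : u <= r + W).
  { pose proof (Rle_abs (u - v)). unfold r. lra. }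
  assert (Hfy := Hgr' y Hy). assert (Hfx := Hgr' x ltac:(lra)).
  fold u in Hfy. fold v in Hfx.
  apply Rle_trans with (M * r + 2 * M * W).
  { pose proof (Rabs_triang (f y) (- f x)) as Htri. rewrite Rabs_Ropp in Htri.
    change (f y + - f x) with (f y - f x) in Htri.
    assert (M * u <= M * (r + W)) by now apply Rmult_le_compat_l.
    assert (M * v <= M * W) by now apply Rmult_le_compat_l.
    lra. }
  assert (H1 : M * r <= M / delta * r ^ 2).
  { replace (M * r) with (M / delta * (delta * r)) by (field; lra).
    apply Rmult_le_compat_l; [exact HC1|]. simpl. rewrite Rmult_1_r.
    apply Rmult_le_compat_r; lra. }
  assert (H2 : 2 * M * W <= 2 * M * W / delta ^ 2 * r ^ 2).
  { replace (2 * M * W) with (2 * M * W / delta ^ 2 * delta ^ 2) at 1 by (field; lra).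
    apply Rmult_le_compat_l; [exact HC2|]. apply pow_incr; lra. }
  lra.
Qed.

(** A quantitative form of the theorem: the error term does not mention [x], and it
    vanishes as [ln a] tends to 1 and [ln a * beta] and [theta / n] tend to 0. *)
Lemma jain_operator_approx (beta a : R) (n : nat) (f : R -> R)
    (d theta C eps x : R) :
  0 <= beta < 1 -> 1 < a <= exp 1 -> (1 <= n)%nat -> 0 < theta -> 0 <= C ->
  ln a * beta + 4 * (theta / INR n) <= 1 / 2 -> 0 <= x <= d ->
  (forall y, 0 <= y ->
     Rabs (f y - f x) <= eps + C * (exp (theta * y) - exp (theta * x)) ^ 2) ->
  ex_series (P_term beta a n f x) /\
  Rabs (P beta a n f x - f x)
    <= eps + C * (exp (2 * theta * d)
         * (exp (d * (2 * theta / (1 - ln a * beta - 4 * (theta / INR n)) - 2 * theta))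
            - 1 + 2 * ((1 - ln a) * theta * d))).
Proof.
intros Hbeta Ha Hn Hth HC Hsmall Hx Hf.
set (L := ln a) in *. set (h := theta / INR n) in *.
assert (HL : 0 < L <= 1).
{ split.
  - rewrite <- ln_1. apply ln_increasing; lra.
  - rewrite <- (ln_exp 1). apply ln_le; lra. }
assert (HN : 0 < INR n) by (apply lt_0_INR; lia).
assert (Hh : 0 < h) by now apply Rdiv_lt_0_compat.
assert (Hb : 0 <= L * beta) by (apply Rmult_le_pos; lra).
assert (Hl : 0 <= L * (INR n * x)).
{ apply Rmult_le_pos; [lra|]. apply Rmult_le_pos; lra. }
set (E := exp (theta * x)).
destruct (gpoisson_exp_variance (L * beta) (L * (INR n * x)) h E)
  as (V & HV & HVle); try lra; [left; apply exp_pos|].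
destruct (weighted_series_approx (gpoisson (L * beta) (L * (INR n * x)))
  (fun k => (exp h ^ k - E) ^ 2) (fun k => f (INR k / INR n)) V (f x) eps C)
  as [Hex Hdist].
- intros k. now apply gpoisson_nonneg.
- apply is_series_gpoisson; lra.
- exact HV.
- intros k. rewrite exp_pow_INR.
  replace (INR k * h) with (theta * (INR k / INR n)) by (unfold h; field; lra).
  apply Hf. apply Rmult_le_pos; [apply pos_INR|left; now apply Rinv_0_lt_compat].
- assert (Hterm : forall k, gpoisson (L * beta) (L * (INR n * x)) k * f (INR k / INR n)
                            = P_term beta a n f x k).
  { intros k. unfold P_term. now rewrite omega_gpoisson. }
  split; [now apply ex_series_ext with (1 := Hterm)|].
  unfold P. rewrite <- (Series_ext _ _ Hterm).
  apply (Rle_trans _ _ _ Hdist), Rplus_le_compat_l, Rmult_le_compat_l; [exact HC|].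
  apply (Rle_trans _ _ _ HVle).
  replace (L * (INR n * x) * (2 * h / (1 - L * beta - 4 * h)))
    with (L * x * (2 * theta / (1 - L * beta - 4 * h))).
  2:{ replace theta with (INR n * h) by (unfold h; field; lra). field. lra. }
  replace (L * (INR n * x) * h) with (L * x * theta) by (unfold h; field; lra).
  apply exp_variance_bound_uniform; try lra.
  apply (Rmult_le_reg_r (1 - L * beta - 4 * h)); [lra|].
  replace (2 * theta / (1 - L * beta - 4 * h) * (1 - L * beta - 4 * h))
    with (2 * theta) by (field; lra).
  assert (0 <= theta * (L * beta + 4 * h)) by (apply Rmult_le_pos; lra). lra.
Qed.

Lemma is_lim_seq_div_INR (c : R) : is_lim_seq (fun n => c / INR n) 0.
Proof.
replace (Finite 0) with (Rbar_mult c 0) by (simpl; f_equal; ring).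
apply (is_lim_seq_scal_l (fun n => / INR n)).
apply (is_lim_seq_inv _ p_infty); [apply is_lim_seq_INR|easy].
Qed.

Theorem theorem1
  (beta a : nat -> R)
  (hbeta : forall n : nat, (1 <= n)%nat -> 0 <= beta n < 1)
  (ha : forall n : nat, (1 <= n)%nat -> 1 < a n <= exp 1)
  (hbeta_lim : is_lim_seq beta 0)
  (ha_lim : is_lim_seq a (exp 1))
  (f : R -> R)
  (hf : continuous_on (fun x : R => 0 <= x) f)
  (hgrowth : exists M A : R, forall x : R, 0 <= x -> Rabs (f x) <= M * exp (A * x))
  (c d : R) (hc : 0 <= c) (hcd : c < d) :
  forall eps : R, 0 < eps ->
    exists N : nat, forall n : nat, (1 <= n)%nat -> (N <= n)%nat ->
      forall x : R, c <= x <= d ->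
        ex_series (P_term (beta n) (a n) n f x) /\
        Rabs (P (beta n) (a n) n f x - f x) < eps.
Proof.
intros eps Heps.
destruct (exp_growth_modulus f d (eps / 2) hf hgrowth) as (theta & C & Hth & HC & Hmod);
  [lra|].
assert (HL : is_lim_seq (fun n => ln (a n)) 1).
{ rewrite <- (ln_exp 1). apply is_lim_seq_continuous; [|exact ha_lim].
  apply continuity_pt_filterlim, continuous_ln, exp_pos. }
assert (Hb : is_lim_seq (fun n => ln (a n) * beta n + 4 * (theta / INR n)) 0).
{ replace (Finite 0) with (Finite (1 * 0 + 4 * 0)) by (f_equal; ring).
  apply is_lim_seq_plus'; [now apply is_lim_seq_mult'|].
  apply is_lim_seq_mult'; [apply is_lim_seq_const|apply is_lim_seq_div_INR]. }
set (rate := fun n => C * (exp (2 * theta * d)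
  * (exp (d * (2 * theta / (1 - ln (a n) * beta n - 4 * (theta / INR n)) - 2 * theta))
     - 1 + 2 * ((1 - ln (a n)) * theta * d)))).
assert (Hrate : is_lim_seq rate 0).
{ replace (Finite 0) with (Finite (C * (exp (2 * theta * d)
    * (exp (d * (2 * theta / (1 - 0) - 2 * theta)) - 1 + 2 * ((1 - 1) * theta * d))))).
  2:{ f_equal. replace (d * (2 * theta / (1 - 0) - 2 * theta)) with 0 by field.
      rewrite exp_0. ring. }
  unfold rate.
  apply is_lim_seq_mult'; [apply is_lim_seq_const|].
  apply is_lim_seq_mult'; [apply is_lim_seq_const|].
  apply is_lim_seq_plus'.
  - apply is_lim_seq_minus'; [|apply is_lim_seq_const].
    apply is_lim_seq_continuous; [apply derivable_continuous_pt, derivable_pt_exp|].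
    apply is_lim_seq_mult'; [apply is_lim_seq_const|].
    apply is_lim_seq_minus'; [|apply is_lim_seq_const].
    apply is_lim_seq_div'; [apply is_lim_seq_const| |lra].
    apply is_lim_seq_ext with
      (fun n => 1 - (ln (a n) * beta n + 4 * (theta / INR n))); [intros n; ring|].
    apply is_lim_seq_minus'; [apply is_lim_seq_const|exact Hb].
  - apply is_lim_seq_mult'; [apply is_lim_seq_const|].
    apply is_lim_seq_mult'; [|apply is_lim_seq_const].
    apply is_lim_seq_mult'; [|apply is_lim_seq_const].
    apply is_lim_seq_minus'; [apply is_lim_seq_const|exact HL]. }
apply is_lim_seq_spec in Hb. apply is_lim_seq_spec in Hrate.
assert (Hhalf : 0 < 1 / 2) by lra. assert (Heps2 : 0 < eps / 2) by lra.
destruct (Hb (mkposreal _ Hhalf)) as [N1 HN1].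
destruct (Hrate (mkposreal _ Heps2)) as [N2 HN2].
exists (max N1 N2). intros n Hn HNn x Hx.
specialize (HN1 n ltac:(lia)). specialize (HN2 n ltac:(lia)). simpl in HN1, HN2.
rewrite Rminus_0_r in HN1, HN2.
apply Rabs_def2 in HN1. apply Rabs_def2 in HN2.
destruct (jain_operator_approx (beta n) (a n) n f d theta C (eps / 2) x) as [Hex Hle];
  auto; try lra.
- intros y Hy. apply Hmod; lra.
- split; [exact Hex|]. fold (rate n) in Hle. lra.
Qed.
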